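(* Let $n>1$ be an integer. Then the rational function $$G_n(y):=y\cdot\frac{T_n\big(\frac1{2y}\big)}{T_{n-1}\big(\frac1{2y}\big)},$$ expanded as a formal power series in $y$, and the formal power series $$1-c_0y^2-c_1y^4-c_2y^6-c_3y^8-\ldots=1-\sum_{k\ge0}c_ky^{2k+2}$$ have the same coefficients of $y^j$ for all $0\le j\le 2n-4$.
   Context: For $n\ge1$, $T_n(x)$ denotes the $n$-th Chebyshev polynomial of the first kind, i.e. the polynomial satisfying $T_n(\cos t)=\cos(nt)$ for all real $t$; equivalently $T_1(x)=x$, $T_2(x)=2x^2-1$ and $T_{n+1}(x)=2xT_n(x)-T_{n-1}(x)$ for $n\ge2$. The $k$-th Catalan number $c_k$ is the number of correct bracket sequences consisting of $k$ pairs of brackets, so $c_0=c_1=1$, $c_2=2$, $c_3=5,\ldots$. (The rational function $G_n(y)$ has a nonzero value at $y=0$ after clearing negative powers, so it expands as a formal power series in $y$.) *)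

(* Defs.v *)
From HB Require Import structures.
From mathcomp Require Import all_boot all_order all_algebra.

Set Implicit Arguments.
Unset Strict Implicit.
Unset Printing Implicit Defensive.

Import Order.TTheory GRing.Theory Num.Theory.
Local Open Scope ring_scope.

(* Setting T_0 = 1 is consistent with the recurrence (T_2 = 2 X T_1 - T_0); *)
(* T_0 does not occur in G_n for n > 1.                                     *)
Fixpoint chebyshev (n : nat) : {poly rat} :=
  match n with
  | 0 => 1
  | 1 => 'X
  | (m.+1 as k).+1 => 2%:R *: ('X * chebyshev k) - chebyshev m
  end.

Local Notation "x %:F" := (tofrac x) : ring_scope.

Notation ratfun := {fraction {poly rat}}.

(* The indeterminate 'X of {poly rat} plays the role of y. *)
Definition yvar : ratfun := ('X : {poly rat})%:F.

Definition ratfun_const (c : rat) : ratfun := (c%:P)%:F.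

Definition ratfun_subst (p : {poly rat}) (g : ratfun) : ratfun :=
  (map_poly ratfun_const p).[g].

Definition G (n : nat) : ratfun :=
  yvar * (ratfun_subst (chebyshev n) (2%:R * yvar)^-1
          / ratfun_subst (chebyshev n.-1) (2%:R * yvar)^-1).

(* A formal power series is given by its coefficient sequence s.  The rational *)
(* function g expands as s when g = p / q with q(0) <> 0 and q * s = p, where  *)
(* * is the Cauchy product of formal power series.                             *)
Definition expands_as (g : ratfun) (s : nat -> rat) : Prop :=
  exists p q : {poly rat},
    [/\ q.[0] != 0,
        g = p%:F / q%:F
      & forall j : nat, \sum_(i < j.+1) q`_i * s (j - i)%N = p`_j].

(* true is an opening bracket, false a closing one. *)
Definition correct_brackets (w : seq bool) : bool :=
  (count_mem true w == count_mem false w) &&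
  [forall i : 'I_(size w).+1,
     (count_mem false (take i w) <= count_mem true (take i w))%N].

Definition catalan (k : nat) : nat :=
  #|[set w : (2 * k).-tuple bool | correct_brackets w]|.

(* Coefficients of 1 - \sum_(k >= 0) c_k y^(2k+2); an even j > 0 is 2k+2 with *)
(* k = j/2 - 1.                                                               *)
Definition catalan_series (j : nat) : rat :=
  if j == 0%N then 1
  else if odd j then 0
  else - (catalan (j./2).-1)%:R.

(* Main.v *)
(**
   Put [P n = 2 y^n T_n(1/(2y))].  These are polynomials with
   [P (n+2) = P (n+1) - y^2 P n], and [G_n = P n / P (n-1)].  The Catalan series
   [C = 1 - y^2 c(y^2)] satisfies [C (1 - C) = y^2], hence
   [P (n+1) - C P n = (1 - C)^n (1 - 2 C)], which is divisible by [y^(2n)].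

   The quadratic equation is obtained by counting nonnegative walks: if [F h]
   is the generating function of the walks from height [h] to [0], then
   [F h = δ_(h,0) + y F (h+1) + y F (h-1)] with [F (-1) = 0], and comparing coefficients
   inductively gives [F (h+1) = y (F 0) (F h)]; so [F 0 = 1 + y^2 (F 0)^2].

   Power series are handled as polynomials modulo ['X^m].
*)
Require Import Defs.
From HB Require Import structures.
From mathcomp Require Import all_boot all_order all_algebra.
From mathcomp Require Import ring zify.

Set Implicit Arguments.
Unset Strict Implicit.
Unset Printing Implicit Defensive.

Import Order.TTheory GRing.Theory Num.Theory.
Local Open Scope ring_scope.

Local Notation "x %:F" := (tofrac x) : ring_scope.

(** * Counting bracket sequences *)

(* [h] is the number of brackets that are already open. *)
Fixpoint closing_word (h : nat) (w : seq bool) : bool :=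
  match w with
  | [::] => h == 0%N
  | true :: w' => closing_word h.+1 w'
  | false :: w' => if h is h'.+1 then closing_word h' w' else false
  end.

Lemma closing_wordP (h : nat) (w : seq bool) :
  reflect ((h + count_mem true w)%N = count_mem false w /\
           forall i, (count_mem false (take i w)
                      <= h + count_mem true (take i w))%N)
          (closing_word h w).
Proof.
elim: w h => [|[] w IHw] h /=.
- by apply: (iffP eqP) => [->|[]]; [split=> // -[] | rewrite addn0].
- apply: (iffP (IHw _)) => -[Ew lew]; split.
  + by rewrite add0n add1n -addSnnS.
  + by case=> [|i] //=; rewrite add0n add1n -addSnnS.
  + by rewrite addSnnS -add1n Ew.
  by move=> i; move: (lew i.+1); rewrite /= add0n add1n -addSnnS.
case: h => [|h]; first by constructor=> -[_ /(_ 1%N)]; rewrite /= take0.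
apply: (iffP (IHw _)) => -[Ew lew]; split.
+ by rewrite add0n add1n addSn Ew.
+ by case=> [|i] //=; rewrite add0n add1n addSn ltnS.
+ by move: Ew; rewrite add0n add1n addSn => -[].
by move=> i; move: (lew i.+1); rewrite /= add0n add1n addSn ltnS.
Qed.

Lemma correct_bracketsE (w : seq bool) :
  correct_brackets w = closing_word 0 w.
Proof.
apply/andP/closing_wordP => -[].
  move/eqP=> Ew /forallP lew; split=> // i.
  (* [correct_brackets] only tests prefix lengths up to [size w]; a longer prefix is [w] itself,
     where both counts agree. *)
  case: (leqP i (size w)) => [lei|/ltnW/take_oversize->].
    by have := lew (Ordinal (lei : (i < (size w).+1)%N)).
  by rewrite add0n Ew.
by move=> Ew lew; split; [apply/eqP | apply/forallP=> i; apply: lew].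
Qed.

(** Each bracket changes the height by one and the final height is 0. This makes the odd
    coefficients vanish. *)
Lemma closing_word_parity (h : nat) (w : seq bool) :
  closing_word h w -> odd (size w) = odd h.
Proof.
elim: w h => [|[] w IHw] [|h] //= /IHw -> //=.
by rewrite negbK.
Qed.

Definition closing_count (h m : nat) : nat :=
  \sum_(w : m.-tuple bool) closing_word h w.

Lemma closing_count0 (h : nat) : closing_count h 0 = (h == 0%N).
Proof.
rewrite /closing_count (bigD1 [tuple]) //= big1 ?addn0 // => w.
by case/eqP; apply: tuple0.
Qed.

Lemma closing_countS (h m : nat) :
  closing_count h m.+1 =
  (closing_count h.+1 m + if h is h'.+1 then closing_count h' m else 0)%N.
Proof.
rewrite /closing_count.
rewrite (reindex (fun p : bool * m.-tuple bool => [tuple of p.1 :: p.2])) /=.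
  rewrite -(pair_bigA _ (fun b (w : m.-tuple bool) =>
             nat_of_bool (closing_word h (b :: w)))) /=.
  by rewrite big_bool /=; congr addn; case: h => //; rewrite big1.
exists (fun w : m.+1.-tuple bool => (thead w, [tuple of behead w])).
  by move=> [b w] _ /=; congr pair; apply/val_inj.
by move=> w _ /=; rewrite -tuple_eta.
Qed.

Lemma closing_count_odd (m : nat) : odd m -> closing_count 0 m = 0%N.
Proof.
move=> om; rewrite /closing_count big1 // => w _.
by case: (boolP (closing_word _ _)) => // /closing_word_parity; rewrite size_tuple om.
Qed.

Lemma catalanE (k : nat) : catalan k = closing_count 0 (2 * k).
Proof.
rewrite /catalan /closing_count -sum1dep_card big_mkcond /=.
by apply: eq_bigr => w _; rewrite correct_bracketsE; case: closing_word.
Qed.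

(** * The generating function of bracket sequences *)

(** The walk equations iterated [m] times starting from 0; this yields [F h] truncated below degree
    [m]. *)
Fixpoint closing_gf (m h : nat) : {poly rat} :=
  if m is m'.+1 then
    (h == 0%N)%:R + 'X * closing_gf m' h.+1 +
    (if h is h'.+1 then 'X * closing_gf m' h' else 0)
  else 0.

Lemma coef_closing_gf (m h j : nat) :
  (closing_gf m h)`_j = if (j < m)%N then (closing_count h j)%:R else 0.
Proof.
elim: m h j => [|m IHm] h j /=; first by rewrite coef0.
rewrite !coefD coefXM -polyC_natr coefC.
case: j => [|j] /=.
  by rewrite closing_count0 addr0; case: h => [|h]; rewrite ?coef0 ?coefXM !addr0.
rewrite ltnS closing_countS natrD add0r IHm.
by case: h => [|h]; rewrite ?coef0 ?coefXM /= ?IHm; case: ifP; rewrite ?addr0.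
Qed.

Lemma dvdXnP (m : nat) (p : {poly rat}) :
  reflect (forall j, (j < m)%N -> p`_j = 0) ('X^m %| p).
Proof.
apply: (iffP idP) => [/dvdpP[q ->] j ltjm|p0]; first by rewrite coefMXn ltjm.
rewrite -[p](poly_take_drop m) dvdp_add ?dvdp_mulIr //.
suff -> : take_poly m p = 0 by rewrite dvdp0.
by apply/polyP=> j; rewrite coef_take_poly coef0; case: ifP => // /p0.
Qed.

Lemma closing_gf_stable (m h : nat) :
  'X^m %| closing_gf m h - closing_gf m.+1 h.
Proof.
apply/dvdXnP=> j ltjm.
by rewrite coefB !coef_closing_gf ltjm (leqW ltjm) subrr.
Qed.

(** Combinatorially, a walk from [h+1] to 0 splits at its first visit to [h]: a walk from [h+1] back
    to [h+1] that never goes below it, a down step, a walk from [h] to 0. The proof is algebraic. *)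
Lemma closing_gf_mul (m h : nat) :
  'X^m %| closing_gf m h.+1 - 'X * closing_gf m 0 * closing_gf m h.
Proof.
elim: m h => [|m IHm] h; first by rewrite expr0 dvd1p.
(* The first three summands contain the claim for [m] at heights [h+1], [h] and 0; the last contains
   a truncation error. The outer ['X] raises the modulus from ['X^m] to ['X^m.+1]. *)
have -> : closing_gf m.+1 h.+1 - 'X * closing_gf m.+1 0 * closing_gf m.+1 h =
  'X * ((closing_gf m h.+2 - 'X * closing_gf m 0 * closing_gf m h.+1)
   + 'X * closing_gf m 0 * (closing_gf m h.+1 - 'X * closing_gf m 0 * closing_gf m h)
   - 'X * closing_gf m h * (closing_gf m 1 - 'X * closing_gf m 0 * closing_gf m 0)
   + (1 + 'X * closing_gf m 1) * (closing_gf m h - closing_gf m.+1 h)).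
  rewrite [closing_gf m.+1 h.+1]/= [closing_gf m.+1 0]/=.
  by move: (closing_gf m.+1 h) => F; ring.
rewrite exprS dvdp_mul2l ?polyX_eq0 //.
apply: dvdp_add; last by rewrite dvdp_mull // closing_gf_stable.
by apply: dvdp_sub; [apply: dvdp_add; rewrite ?dvdp_mull|rewrite dvdp_mull].
Qed.

(** Substitute [F 1 = y (F 0)^2] into [F 0 = 1 + y (F 1)]. *)
Lemma closing_gf_quadratic (m : nat) :
  'X^m %| closing_gf m 0 - 1 - 'X^2 * closing_gf m 0 ^+ 2.
Proof.
have -> : closing_gf m 0 - 1 - 'X^2 * closing_gf m 0 ^+ 2 =
  (closing_gf m 0 - closing_gf m.+1 0)
  + 'X * (closing_gf m 1 - 'X * closing_gf m 0 * closing_gf m 0).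
  by rewrite [closing_gf m.+1 0]/=; ring.
by rewrite dvdp_add ?dvdp_mull ?closing_gf_mul ?closing_gf_stable.
Qed.

Definition catalan_poly (m : nat) : {poly rat} := 1 - 'X^2 * closing_gf m 0.

Lemma coef_catalan_poly (m j : nat) :
  (j < m)%N -> (catalan_poly m)`_j = catalan_series j.
Proof.
rewrite /catalan_poly /catalan_series coefB coef1 coefXnM coef_closing_gf.
case: j => [|[|j]] ltjm; rewrite ?subr0 //= subn2 /= negbK.
rewrite (ltnW (ltnW ltjm)) sub0r.
case: (boolP (odd j)) => [/closing_count_odd->|even_j]; first by rewrite oppr0.
by rewrite catalanE mul2n halfK (negbTE even_j) subn0.
Qed.

(** * Reversed Chebyshev polynomials *)

(** This is [P n]. The factor 2 makes the constant term 1 for [n >= 1] and cancels in the ratio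
    [G n]. *)
Fixpoint rev_chebyshev (n : nat) : {poly rat} :=
  match n with
  | 0 => 2%:R
  | 1 => 1
  | (m.+1 as k).+1 => rev_chebyshev k - 'X^2 * rev_chebyshev m
  end.

Lemma rev_chebyshevSS (n : nat) :
  rev_chebyshev n.+2 = rev_chebyshev n.+1 - 'X^2 * rev_chebyshev n.
Proof. by []. Qed.

Lemma chebyshevSS (n : nat) :
  chebyshev n.+2 = 2%:R *: ('X * chebyshev n.+1) - chebyshev n.
Proof. by []. Qed.

Lemma rev_chebyshev_at0 (n : nat) : (rev_chebyshev n.+1)`_0 = 1.
Proof.
elim: n => [|n IHn]; first by rewrite coef1.
by rewrite rev_chebyshevSS coefB IHn coefXnM subr0.
Qed.

(** Since [C (1 - C) = y^2], passing from [n] to [n+1] multiplies [P (n+1) - C P n] by [1 - C]; the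
    initial value is [1 - 2 C]. *)
Lemma rev_chebyshev_catalan (m n : nat) :
  'X^m %| rev_chebyshev n.+1 - catalan_poly m * rev_chebyshev n
          - (1 - catalan_poly m) ^+ n * (1 - 2%:R * catalan_poly m).
Proof.
elim: n => [|n IHn].
  by rewrite expr0 mul1r /= [_ * 2%:R]mulrC subrr dvdp0.
set C := catalan_poly m in IHn *.
(* The last summand is [P n (C (1 - C) - y^2)], the error of the quadratic equation modulo
   ['X^m]. *)
have -> : rev_chebyshev n.+2 - C * rev_chebyshev n.+1
          - (1 - C) ^+ n.+1 * (1 - 2%:R * C) =
  (1 - C) * (rev_chebyshev n.+1 - C * rev_chebyshev n
             - (1 - C) ^+ n * (1 - 2%:R * C))
  + rev_chebyshev n * 'X^2 * (closing_gf m 0 - 1 - 'X^2 * closing_gf m 0 ^+ 2).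
  by rewrite rev_chebyshevSS [_ ^+ n.+1]exprS /C /catalan_poly; ring.
by rewrite dvdp_add ?dvdp_mull ?closing_gf_quadratic.
Qed.

Lemma rev_chebyshev_approx (n : nat) :
  'X^(2 * n) %| rev_chebyshev n.+1 - catalan_poly (2 * n) * rev_chebyshev n.
Proof.
have := rev_chebyshev_catalan (2 * n) n; rewrite dvdp_subl //.
(* [1 - C] is ['X^2 * closing_gf _ 0], so its [n]-th power is divisible by ['X^(2 * n)]. *)
by rewrite dvdp_mulr // /catalan_poly opprB addrC subrK exprMn -exprM dvdp_mulr.
Qed.

(** Shows [ratfun_const] as a composition of ring morphisms, so that the morphism lemmas apply to
    the substitution. *)
Lemma ratfun_substE (p : {poly rat}) (g : ratfun) :
  ratfun_subst p g = (map_poly (@tofrac _ \o polyC) p).[g].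
Proof. by []. Qed.

Lemma yvar_neq0 : yvar != 0.
Proof. by rewrite tofrac_eq0 polyX_eq0. Qed.

Lemma ratfun2_neq0 : 2%:R != 0 :> ratfun.
Proof. by rewrite -(rmorph_nat (@tofrac _)) tofrac_eq0 -polyC_natr polyC_eq0. Qed.

Lemma ratfun_subst_chebyshev0 (g : ratfun) : ratfun_subst (chebyshev 0) g = 1.
Proof. by rewrite ratfun_substE rmorph1 hornerC. Qed.

Lemma ratfun_subst_chebyshev1 (g : ratfun) : ratfun_subst (chebyshev 1) g = g.
Proof. by rewrite ratfun_substE map_polyX hornerX. Qed.

Lemma ratfun_subst_chebyshevSS (n : nat) (g : ratfun) :
  ratfun_subst (chebyshev n.+2) g =
  2%:R * (g * ratfun_subst (chebyshev n.+1) g) - ratfun_subst (chebyshev n) g.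
Proof.
rewrite chebyshevSS !ratfun_substE rmorphB hornerD hornerN; congr (_ - _).
rewrite scaler_nat rmorphMn hornerMn rmorphM /= map_polyX hornerM hornerX.
by rewrite mulr_natl.
Qed.

(** The Chebyshev recurrence at [x = 1/(2y)], where [2x = 1/y], scaled by [2 y^(n+2)]. *)
Lemma rev_chebyshev_step (K : fieldType) (n : nat) (y a b : K) :
  y != 0 -> 2%:R != 0 :> K ->
  2%:R * y ^+ n.+2 * (2%:R * ((2%:R * y)^-1 * a) - b) =
  2%:R * y ^+ n.+1 * a - y ^+ 2 * (2%:R * y ^+ n * b).
Proof. by move=> yN0 twoN0; rewrite !exprS; field; rewrite yN0 twoN0. Qed.

Lemma rev_chebyshev_subst (n : nat) :
  2%:R * yvar ^+ n * ratfun_subst (chebyshev n) (2%:R * yvar)^-1 =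
  (rev_chebyshev n)%:F.
Proof.
(* The recurrence has two steps, so the induction carries two consecutive indices. *)
suff: 2%:R * yvar ^+ n * ratfun_subst (chebyshev n) (2%:R * yvar)^-1 =
        (rev_chebyshev n)%:F /\
      2%:R * yvar ^+ n.+1 * ratfun_subst (chebyshev n.+1) (2%:R * yvar)^-1 =
        (rev_chebyshev n.+1)%:F by case.
elim: n => [|n [IHn IHn1]]; split=> //.
- by rewrite ratfun_subst_chebyshev0 expr0 !mulr1 rmorph_nat.
- rewrite ratfun_subst_chebyshev1 expr1 rmorph1.
  exact: divff (mulf_neq0 ratfun2_neq0 yvar_neq0).
rewrite ratfun_subst_chebyshevSS (rev_chebyshev_step _ _ _ yvar_neq0 ratfun2_neq0).
by rewrite IHn IHn1 rev_chebyshevSS rmorphB rmorphM rmorphXn.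
Qed.

Lemma scaled_ratio (K : fieldType) (n : nat) (y a b : K) :
  y != 0 -> 2%:R != 0 :> K ->
  y * (a / b) = (2%:R * y ^+ n.+1 * a) / (2%:R * y ^+ n * b).
Proof.
move=> yN0 twoN0; rewrite -mulf_div -(mulf_div _ 2%:R) divff // mul1r exprS.
by rewrite mulfK ?expf_neq0.
Qed.

Lemma G_rev_chebyshev (n : nat) :
  G n.+1 = (rev_chebyshev n.+1)%:F / (rev_chebyshev n)%:F.
Proof.
by rewrite /G (scaled_ratio n _ _ yvar_neq0 ratfun2_neq0) !rev_chebyshev_subst.
Qed.

(** * Expansion of rational functions *)

(** Division by increasing powers: each round adds the monomial that cancels the lowest remaining
    coefficient of [p - q * r]. *)
Fixpoint quotient_trunc (p q : {poly rat}) (m : nat) : {poly rat} :=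
  if m is m'.+1 then
    let r := quotient_trunc p q m' in
    r + ((p - q * r)`_m' / q`_0) *: 'X^m'
  else 0.

Lemma coef_quotient_trunc (p q : {poly rat}) (m j : nat) :
  (quotient_trunc p q m)`_j =
  if (j < m)%N then (quotient_trunc p q j.+1)`_j else 0.
Proof.
elim: m => [|m IHm]; first by rewrite coef0.
rewrite [LHS]/= coefD coefZ coefXn IHm ltnS.
case: (ltngtP j m) => [_|_|eq_jm]; rewrite ?mulr0 ?addr0 //.
subst m; rewrite ltnn in IHm.
by rewrite [quotient_trunc p q j.+1]/= [in RHS]coefD coefZ coefXn eqxx IHm.
Qed.

Lemma quotient_truncP (p q : {poly rat}) (m : nat) :
  q`_0 != 0 -> 'X^m %| p - q * quotient_trunc p q m.
Proof.
move=> q0; apply/dvdXnP; elim: m => [|m IHm] j //.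
set r := quotient_trunc p q m in IHm.
rewrite [quotient_trunc _ _ _]/= -/r mulrDr opprD addrA coefB -scalerAr coefZ coefMXn.
rewrite ltnS leq_eqVlt => /predU1P[->|ltjm].
  by rewrite ltnn subnn mulfVK ?subrr.
by rewrite ltjm mulr0 subr0 IHm.
Qed.

Lemma expands_as_exists (p q : {poly rat}) :
  q`_0 != 0 -> exists s, expands_as (p%:F / q%:F) s.
Proof.
move=> q0; exists (fun j => (quotient_trunc p q j.+1)`_j).
exists p, q; split=> [||j]; rewrite ?horner_coef0 //.
have /dvdXnP/(_ j (ltnSn j)) := quotient_truncP p j.+1 q0.
rewrite coefB => /subr0_eq ->; rewrite coefM; apply: eq_bigr => i _.
by rewrite [in RHS]coef_quotient_trunc ltnS leq_subr.
Qed.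

Lemma coprimep_Xn (m : nat) (q : {poly rat}) :
  q`_0 != 0 -> coprimep 'X^m q.
Proof.
move=> q0; apply: coprimep_expl.
by rewrite coprimep_sym -['X]subr0 -polyC0 coprimep_XsubC rootE horner_coef0.
Qed.

(** The expansion may be witnessed by another fraction [p' / q']; cross-multiplication moves it to
    [p / q], and [q'] cancels because it is coprime to ['X^m]. *)
Lemma expands_as_trunc (p q : {poly rat}) (s : nat -> rat) (m : nat) :
  q`_0 != 0 -> expands_as (p%:F / q%:F) s ->
  'X^m %| p - q * \poly_(i < m) s i.
Proof.
move=> q0 [p' [q' [q'0 Epq Es]]].
rewrite horner_coef0 in q'0.
have neq0 (r : {poly rat}) : r`_0 != 0 -> r%:F != 0.
  by rewrite tofrac_eq0; apply: contraNneq => ->; rewrite coef0.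
have Ecross : p * q' = p' * q.
  apply/eqP; rewrite -tofrac_eq !rmorphM /=.
  by rewrite -eqr_div ?neq0 // Epq.
rewrite -(Gauss_dvdpr _ (coprimep_Xn m q'0)).
set S := \poly_(i < m) s i.
have -> : q' * (p - q * S) = q * (p' - q' * S).
  by rewrite !mulrBr mulrC Ecross; ring.
apply/dvdp_mull/dvdXnP=> j ltjm.
rewrite coefB -Es coefM -sumrB big1 // => i _.
by rewrite coef_poly (leq_ltn_trans (leq_subr _ _) ltjm) subrr.
Qed.

Theorem theorem1 (n : nat) (hn : (1 < n)%N) :
  (exists s : nat -> rat, expands_as (G n) s) /\
  (forall s : nat -> rat, expands_as (G n) s ->
     forall j : nat, (j <= 2 * n - 4)%N -> s j = catalan_series j).
Proof.
case: n hn => [|[|n]] // _; rewrite G_rev_chebyshev.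
have P0 : (rev_chebyshev n.+1)`_0 != 0 by rewrite rev_chebyshev_at0 oner_eq0.
split=> [|s Es j lej]; first exact: expands_as_exists.
(* The index is now [n.+2], so [j <= 2 * n], below the precision [2 * n.+1] of the approximation. *)
have ltj : (j < 2 * n.+1)%N by lia.
have := dvdp_sub (rev_chebyshev_approx n.+1) (expands_as_trunc (2 * n.+1) P0 Es).
(* The difference of the two congruences is [P (n+1)] times (truncation of [s] minus [C]), and
   [P (n+1)] has constant term 1, so it cancels. *)
rewrite opprB addrC addrA subrK [catalan_poly _ * _]mulrC -mulrBr.
rewrite Gauss_dvdpr ?coprimep_Xn // => /dvdXnP/(_ j ltj).
by rewrite coefB coef_poly ltj coef_catalan_poly // => /subr0_eq.
Qed.
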